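(* Let $f:\mathbb{R}^n\to\mathbb{R}$ be a continuous selection of $\mathcal{C}^1$-functions $f_i:\mathbb{R}^n\to\mathbb{R}$, $i\in I=\{1,\dots,m\}$, whose gradients $\nabla f_i$ are locally Lipschitz continuous. Assume that $f$ has a critical point $x^*\in\mathbb{R}^n$ such that: (i) there is $\alpha\in\mathbb{R}^m$ with $\alpha_i>0$ for all $i\in I$ and $\sum_{i=1}^m\alpha_i\nabla f_i(x^* )=0$; (ii) the vectors $\nabla f_i(x^* )$, $i\in I$, are affinely independent; (iii) $x^*$ is the unique global minimum of $f$, and there is some $z\in\mathbb{R}^n\setminus\{x^*\}$ such that $\{x\in\mathbb{R}^n: f(x)\le f(z)\}$ is bounded. Then there is an open neighborhood $U\subseteq\mathbb{R}^n$ of $x^*$ such that the following holds. Suppose the quasi-Newton method is applied to $f$ with an initial point $x^0\in U$ and generates a sequence $(x^k)_k$ and corresponding quasi-Newton matrices $(H_k)_k$, with eigenvalues $0<\lambda_1^k\le\dots\le\lambda_n^k$ of $H_k$, such that 1. $(x^k)_k$ is an infinite sequence, i.e., the method does not break down and $\nabla f(x^k)\ne 0$ for all $k\in\mathbb{N}$; 2. $(x^k)_k$ has a limit $\bar{x}\in\mathbb{R}^n$; 3. for all $i\in I$, the set $\{k\in\mathbb{N}: i\in I_g(x^k)\}$ is infinite; 4. there are $\sigma_L,\sigma_U>0$ such that $\lambda_j^k\in[\sigma_L,\sigma_U]$ for all $j\in\{\dim(\mathcal{N}(\bar{x}))+1,\dots,n\}$ and $k\in\mathbb{N}$; 5. $\lim_{k\to\infty}H_k(\nabla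 f_i(\bar{x})-\nabla f_1(\bar{x}))=0$ for all $i\in\{2,\dots,m\}$. Then the limit $\bar{x}$ is a critical point of $f$.
   Context: Continuous selection: $f:\mathbb{R}^n\to\mathbb{R}$ is a continuous selection of $f_i$, $i\in I=\{1,\dots,m\}$, $m\in\mathbb{N}$, if $f$ is continuous and $f(x)\in\{f_i(x): i\in I\}$ for all $x\in\mathbb{R}^n$. $\Omega$ denotes the set of points at which $f$ is not differentiable. The essentially active set is $I_e(x)=\{i\in I: x\in\mathrm{cl}(\mathrm{int}(\{y\in\mathbb{R}^n: f(y)=f_i(y)\}))\}$. For $x\notin\Omega$, $I_g(x)=\{i\in I_e(x):\nabla f(x)=\nabla f_i(x)\}$. Critical point: $x$ is critical if $0\in\partial f(x)$, where $\partial f$ is the Clarke subdifferential; for continuous selections of $\mathcal{C}^1$-functions, $\partial f(x)=\mathrm{conv}(\{\nabla f_i(x): i\in I_e(x)\})$. For $\bar{x}\in\mathbb{R}^n$, $\mathcal{N}(\bar{x})=\mathrm{span}(\{\nabla f_i(\bar{x})-\nabla f_1(\bar{x}): i\in\{2,\dots,m\}\})$. Wolfe conditions: for $x\notin\Omega$, $p\in\mathbb{R}^n$ with $\nabla f(x)^\top p<0$, and $c_1,c_2\in(0,1)$ with $c_1<c_2$, a step length $t>0$ satisfies the Wolfe conditions if $x+tp\notin\Omega$, $f(x+tp)\le f(x)+c_1t\nabla f(x)^\top p$, and $\nabla f(x+tp)^\top p\ge c_2\nabla f(x)^\top p$. Quasi-Newton method: Given an initial point $x^0\in\mathbb{R}^n\setminus\Omega$,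 an initial symmetric positive definite matrix $H_0\in\mathbb{R}^{n\times n}$, and $c_1,c_2\in(0,1)$ with $c_1<c_2$, for $k=0,1,\dots$: if $\nabla f(x^k)=0$ stop; set $p^k=-H_k\nabla f(x^k)$; set $x^{k+1}=x^k+t_kp^k$ where $t_k>0$ satisfies the Wolfe conditions (at $x^k$ with direction $p^k$); if $f$ is not differentiable at $x^{k+1}$ stop (the method ''breaks down''); for $y^k=\nabla f(x^{k+1})-\nabla f(x^k)$ and $s^k=x^{k+1}-x^k$, choose any symmetric positive definite matrix $H_{k+1}\in\mathbb{R}^{n\times n}$ with $H_{k+1}y^k=s^k$. (No particular choice of $t_k$ or update formula for $H_{k+1}$ is prescribed.) *)

(* Defs.v *)
From mathcomp Require Import all_boot all_order all_algebra.
From mathcomp Require Import all_classical all_reals all_analysis.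

Set Implicit Arguments.
Unset Strict Implicit.
Unset Printing Implicit Defensive.

Import Order.TTheory GRing.Theory Num.Theory.
Import numFieldNormedType.Exports.

Local Open Scope classical_set_scope.
Local Open Scope ring_scope.

Section Gradients.
Context {R : realType} {n : nat}.
Implicit Types (f : 'cV[R]_n -> R) (x : 'cV[R]_n).

Definition dotp (u v : 'cV[R]_n) : R := (u^T *m v) 0 0.

(* Meaningful only where f is differentiable; every use below is guarded. *)
Definition grad f x : 'cV[R]_n := \col_(i < n) 'D_(delta_mx i 0) f x.

Definition Omega f : set 'cV[R]_n := [set x | ~ differentiable f x].

Definition C1 f : Prop := (forall x, differentiable f x) /\ continuous (grad f).

Definition locally_lipschitz (g : 'cV[R]_n -> 'cV[R]_n) : Prop :=
  forall x, exists2 V : set 'cV[R]_n, nbhs x V & [lipschitz g y | y in V].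

Definition convex_hull (S : set 'cV[R]_n) : set 'cV[R]_n :=
  [set v | exists (k : nat) (a : 'I_k -> R) (s : 'I_k -> 'cV[R]_n),
    [/\ forall i, 0 <= a i, \sum_i a i = 1, forall i, S (s i) &
        v = \sum_i a i *: s i]].

(* Convex hull of all limits of gradients along sequences of differentiability
   points; this is the Clarke subdifferential for locally Lipschitz f, which
   includes every continuous selection of C^1 functions. *)
Definition clarke f x : set 'cV[R]_n :=
  convex_hull [set g | exists u : nat -> 'cV[R]_n,
    [/\ forall j, ~ Omega f (u j),
        u j @[j --> \oo] --> x &
        grad f (u j) @[j --> \oo] --> g]].

Definition critical f x : Prop := clarke f x 0.

End Gradients.

(* The index set {1, ..., m} with m >= 1 is encoded as 'I_m.+1: the m of the
   code is one less than the number of selection functions, and ord0 stands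
   for the index 1. *)
Section Selections.
Context {R : realType} {n m : nat}.
Implicit Types (f : 'cV[R]_n -> R) (fs : 'I_m.+1 -> 'cV[R]_n -> R)
  (x : 'cV[R]_n).

Definition continuous_selection f fs : Prop :=
  continuous f /\ forall x, exists i, f x = fs i x.

Definition Ie f fs x : set 'I_m.+1 :=
  [set i | closure (interior [set y | f y = fs i y]) x].

(* Used only at points outside Omega f. *)
Definition Ig f fs x : set 'I_m.+1 :=
  [set i | Ie f fs x i /\ grad f x = grad (fs i) x].

Definition Nspace fs x : {vspace 'cV[R]_n} :=
  <<[seq grad (fs i) x - grad (fs ord0) x | i <- enum 'I_m.+1 & i != ord0]>>%VS.

Definition affinely_independent (v : 'I_m.+1 -> 'cV[R]_n) : Prop :=
  forall c : 'I_m.+1 -> R,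
    \sum_i c i = 0 -> \sum_i c i *: v i = 0 -> forall i, c i = 0.

End Selections.

Section QuasiNewton.
Context {R : realType} {n : nat}.
Implicit Types (f : 'cV[R]_n -> R).

Definition posdefmx (A : 'M[R]_n) : Prop :=
  A \is symmetricmx /\ forall v : 'cV[R]_n, v != 0 -> 0 < dotp v (A *m v).

(* All n eigenvalues with multiplicity, in nondecreasing order; l is indexed
   from 0. *)
Definition ordered_eigenvalues (A : 'M[R]_n) (l : 'I_n -> R) : Prop :=
  {homo l : i j / (i <= j)%N >-> i <= j} /\
  char_poly A = \prod_i ('X - (l i)%:P).

Definition wolfe f (c1 c2 : R) (x p : 'cV[R]_n) (t : R) : Prop :=
  [/\ 0 < t,
      ~ Omega f (x + t *: p),
      f (x + t *: p) <= f x + c1 * t * dotp (grad f x) p &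
      dotp (grad f (x + t *: p)) p >= c2 * dotp (grad f x) p].

(* x, H and t are total sequences; their values are constrained only up to the
   first stopping index, so finite runs are covered as well.  [running k] says
   that the method has not stopped before computing the direction p^k. *)
Definition running f (x : nat -> 'cV[R]_n) (k : nat) : Prop :=
  forall l, (l <= k)%N -> ~ Omega f (x l) /\ grad f (x l) <> 0.

Record quasi_newton f (c1 c2 : R) (x : nat -> 'cV[R]_n) (H : nat -> 'M[R]_n)
    (t : nat -> R) : Prop := QuasiNewton {
  qn_start : ~ Omega f (x 0%N);
  qn_matrix0 : posdefmx (H 0%N);
  qn_step : forall k, running f x k ->
    let p := - (H k *m grad f (x k)) in
    wolfe f c1 c2 (x k) p (t k) /\ x k.+1 = x k + t k *: p;
  qn_update : forall k, running f x k -> ~ Omega f (x k.+1) ->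
    posdefmx (H k.+1) /\
    H k.+1 *m (grad f (x k.+1) - grad f (x k)) = x k.+1 - x k }.

End QuasiNewton.

(* Main.v *)
Require Import Defs.
From mathcomp Require Import all_boot all_order all_algebra.
From mathcomp Require Import all_classical all_reals all_analysis.
From mathcomp Require Import ring lra.
Set Implicit Arguments.
Unset Strict Implicit.
Unset Printing Implicit Defensive.
Import Order.TTheory GRing.Theory Num.Theory.
Import numFieldNormedType.Exports.
Local Open Scope classical_set_scope.
Local Open Scope ring_scope.

(* Let F be an ultrafilter finer than \oo.  If dim (Nspace fs xbar) < n, as we
   may assume, the upper bound on the largest eigenvalue bounds the H k, so along F they converge to a symmetric
   positive semidefinite matrix A that vanishes on N = Nspace fs xbar.  The
   gradients at x k and x k.+1 converge along F to two of the vectors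
   g i = grad (fs i) xbar, and A g i = A g 0 for all i, so the curvature
   condition becomes - q >= - c2 q with q = g0^T A g0 in the limit; hence q = 0
   and A g0 = 0.  If g0 were not in N, then A would have a kernel of dimension
   greater than dim N, hence the eigenvalue 0 with multiplicity greater than
   dim N, whereas all but dim N eigenvalues stay above sigmaL.  So g0 is in N,
   i.e. 0 is an affine combination of the g i.  Near xs affine independence
   forces its coefficients to be close to those at xs, which are positive;
   and xbar is near xs because f decreases along the iterates and the sublevel
   sets of f shrink to xs. *)

(** * Limits of matrices along filters, and compactness and finite covers along ultrafilters *)

Section UltrafilterLimits.
Context {R : realType}.

Lemma cvg_mxP {T : Type} (F : set_system T) {FF : Filter F} (m n : nat)
    (u : T -> 'M[R]_(m, n)) (A : 'M[R]_(m, n)) :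
  u @ F --> A <-> forall i j, u k i j @[k --> F] --> A i j.
Proof.
split=> [uA i j|uA].
  exact: (cvg_comp _ _ uA (@coord_continuous _ _ _ i j A)).
apply/cvg_ballP => e e0.
have : \forall k \near F, forall i j, ball (A i j) e (u k i j).
  apply: filter_forall => i; apply: filter_forall => j.
  by have /cvg_ballP/(_ _ e0) := uA i j.
by apply: filterS => k ballk; split.
Qed.

Lemma cvg_sumr {T : Type} {F : set_system T} {FF : Filter F} (I : Type)
    (r : seq I) (P : pred I) (f : I -> T -> R) (a : I -> R) :
  (forall i, f i @ F --> a i) ->
  \sum_(i <- r | P i) f i k @[k --> F] --> \sum_(i <- r | P i) a i.
Proof.
by move=> fa; apply: cvg_big => [|i _]; [exact: add_continuous | exact: fa].
Qed.

Lemma cvg_prodr {T : Type} {F : set_system T} {FF : Filter F} (I : Type)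
    (r : seq I) (P : pred I) (f : I -> T -> R) (a : I -> R) :
  (forall i, f i @ F --> a i) ->
  \prod_(i <- r | P i) f i k @[k --> F] --> \prod_(i <- r | P i) a i.
Proof.
by move=> fa; apply: cvg_big => [|i _]; [exact: mul_continuous | exact: fa].
Qed.

Lemma cvg_mulmx {T : Type} {F : set_system T} {FF : Filter F} (m n p : nat)
    (u : T -> 'M[R]_(m, n)) (v : T -> 'M[R]_(n, p))
    (A : 'M[R]_(m, n)) (B : 'M[R]_(n, p)) :
  u @ F --> A -> v @ F --> B -> u k *m v k @[k --> F] --> A *m B.
Proof.
move=> /cvg_mxP uA /cvg_mxP vB; apply/cvg_mxP => i j; rewrite mxE.
under eq_cvg do rewrite mxE.
by apply: cvg_sumr => l; apply: cvgM.
Qed.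

Lemma cvg_dotp {T : Type} {F : set_system T} {FF : Filter F} (n : nat)
    (u v : T -> 'cV[R]_n) (a b : 'cV[R]_n) :
  u @ F --> a -> v @ F --> b -> dotp (u k) (v k) @[k --> F] --> dotp a b.
Proof.
move=> ua vb; have /cvg_mxP : (u k)^T *m v k @[k --> F] --> a^T *m b.
  apply: cvg_mulmx => //; apply/cvg_mxP => i j; rewrite mxE.
  under eq_cvg do rewrite mxE.
  by move/cvg_mxP: ua; exact.
exact.
Qed.

Lemma cvg_det {T : Type} {F : set_system T} {FF : Filter F} (n : nat)
    (u : T -> 'M[R]_n) (A : 'M[R]_n) :
  u @ F --> A -> \det (u k) @[k --> F] --> \det A.
Proof.
move=> /cvg_mxP uA; apply: cvg_sumr => s.
by apply: cvgM; [exact: cvg_cst|apply: cvg_prodr => i].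
Qed.

(** The image of [F] under [u] is again an ultrafilter, and it contains the compact segment
    [[- M, M]]. This replaces the extraction of convergent subsequences. *)
Lemma ultra_bounded_cvgr {T : Type} (F : set_system T) (u : T -> R) (M : R) :
  UltraFilter F -> (forall k, `|u k| <= M) -> exists l : R, u @ F --> l.
Proof.
move=> UF uM.
have : compact (`[- M, M]%classic : set R) by exact: segment_compact.
rewrite compact_ultra => /(_ (u @ F)) [||l [_ ul]].
- split=> [|G GF uFG]; first exact: fmap_proper_filter.
  rewrite eqEsubset; split=> // A GA.
  have [//|FA] := in_ultra_setVsetC (u @^-1` A) UF.
  have /(filterI GA) : G (~` A) by apply: uFG.
  by rewrite setICr => /filter_not_empty.
- change (F (u @^-1` `[- M, M]%classic)); apply: filterE => k /=.
  by rewrite in_itv /= -ler_norml uM.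
- by exists l.
Qed.

Lemma ultra_bounded_cvg_mx {T : Type} (F : set_system T) (m n : nat)
    (u : T -> 'M[R]_(m, n)) (M : R) :
  UltraFilter F -> (forall k i j, `|u k i j| <= M) ->
  exists l : 'M[R]_(m, n), u @ F --> l.
Proof.
move=> UF uM.
have /choice [l ul] (i : 'I_m) : exists l : 'I_n -> R,
    forall j, u k i j @[k --> F] --> l j.
  have /choice [l ul] (j : 'I_n) : exists l : R, u k i j @[k --> F] --> l.
    by apply: (@ultra_bounded_cvgr _ _ _ M) => // k; exact: uM.
  by exists l.
by exists (\matrix_(i, j) l i j); apply/cvg_mxP => i j; rewrite mxE.
Qed.

(** Otherwise all the complements lie in [F], and so does their finite intersection. It serves to
    fix one active selection function along [F]. *)
Lemma ultra_cover {T : Type} (F : set_system T) (I : finType) (P : I -> set T) :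
  UltraFilter F -> (\forall k \near F, exists i, P i k) ->
  exists i, \forall k \near F, P i k.
Proof.
move=> UF FP; apply: contrapT => /forallNP nP.
have /filter_forall : forall i, \forall k \near F, ~ P i k.
  by move=> i; have [/nP|] := in_ultra_setVsetC (P i) UF.
move=> /(filterI FP) /filter_ex [k [[i Pik]]].
by move=> /(_ i).
Qed.

End UltrafilterLimits.

(** * At a differentiability point, the gradient of a selection is that of a selection function *)

Section GradientSelection.
Context {R : realType}.

Lemma poly_eq0_fun (p : {poly R}) : (forall t, p.[t] = 0) -> p = 0.
Proof.
move=> p0; apply/eqP; apply: contraT => pN0.
have /(max_poly_roots pN0) : all (root p) [seq i%:R | i <- iota 0 (size p)].
  by apply/allP => t _; exact/rootP.
rewrite size_map size_iota ltnn; apply.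
by rewrite map_inj_uniq ?iota_uniq // => i j /eqP; rewrite eqr_nat => /eqP.
Qed.

Context {n : nat}.
Implicit Types (f : 'cV[R]_n -> R) (x v : 'cV[R]_n).

Lemma dotpE u v : dotp u v = \sum_i u i 0 * v i 0 :> R.
Proof. by rewrite /dotp mxE; apply: eq_bigr => i _; rewrite mxE. Qed.

Lemma dotp_grad f x v : differentiable f x -> dotp (grad f x) v = 'D_v f x.
Proof.
move=> df; rewrite deriveE // dotpE [in RHS](matrix_sum_delta v) linear_sum.
apply: eq_bigr => i _; rewrite big_ord1 linearZ /= mxE deriveE //.
by rewrite mulrC.
Qed.

Context {m : nat}.

(** Along an ultrafilter of nonzero steps h tending to 0, a single [fs i] agrees with [f] at x + h
    v. The two difference quotients then coincide along it, and so do their limits. *)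
Lemma derive_selection f (fs : 'I_m.+1 -> 'cV[R]_n -> R) x v :
  continuous_selection f fs -> (forall i, differentiable (fs i) x) ->
  differentiable f x -> exists i, 'D_v f x = 'D_v (fs i) x.
Proof.
move=> [fC fsel] dfs df.
have [F [UF F0]] := ultraFilterLemma (Proper_dnbhs_numFieldType (0 : R)).
have [|i Fi] := ultra_cover
  (P := fun i h => f (h *: v + x) = fs i (h *: v + x)) UF.
  by apply: filterE => h; exact: fsel.
exists i.
have hx : h *: v + x @[h --> F] --> x.
  have h0 : id @ F --> (0 : R) by apply: cvg_trans (@nbhs_dnbhs _ _); exact: F0.
  rewrite -[x in _ --> x]add0r -(scale0r v).
  by apply: cvgD; [exact: cvgZl|exact: cvg_cst].
have fx : f x = fs i x.
  have fx := cvg_comp _ _ hx (fC x).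
  have fsx := cvg_comp _ _ hx (differentiable_continuous (dfs i)).
  apply: (norm_cvg_unique fx); apply: cvg_trans fsx.
  by apply: near_eq_cvg; apply: filterS Fi => h /= ->.
have Df := cvg_trans (cvg_app _ F0) (@diff_derivable _ _ _ _ _ v df).
have Dfs := cvg_trans (cvg_app _ F0) (@diff_derivable _ _ _ _ _ v (dfs i)).
apply: (norm_cvg_unique Df); apply: cvg_trans Dfs.
by apply: near_eq_cvg; apply: filterS Fi => h /= ->; rewrite fx.
Qed.

(** The index from [derive_selection] depends on the direction. On the moment curve (1, t, ...,
    t^(n-1)) the difference of directional derivatives is a polynomial [p i] in t. If no gradient
    agreed, every [p i] would be nonzero, yet their product vanishes at every t. *)
Lemma grad_selection f (fs : 'I_m.+1 -> 'cV[R]_n -> R) x :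
  continuous_selection f fs -> (forall i, differentiable (fs i) x) ->
  differentiable f x -> exists i, grad f x = grad (fs i) x.
Proof.
move=> fsel dfs df; apply: contrapT => /forallNP gN.
pose p i : {poly R} :=
  \sum_(j < n) (grad f x j 0 - grad (fs i) x j 0) *: 'X^j.
have pE i t : (p i).[t] = 'D_(\col_j t ^+ j) f x - 'D_(\col_j t ^+ j) (fs i) x.
  rewrite -!dotp_grad // !dotpE -sumrB horner_sum.
  by apply: eq_bigr => j _; rewrite !mxE hornerZ hornerXn -mulrBl.
have pN0 i : p i != 0.
  apply/eqP => p0; apply: (gN i); apply/colP => j; apply/eqP.
  rewrite -subr_eq0; apply/eqP.
  have := congr1 (fun q : {poly R} => q`_j) p0.
  rewrite coef0 coef_sum (bigD1 j) //= coefZ coefXn eqxx mulr1.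
  rewrite big1 ?addr0 // => l lj; rewrite coefZ coefXn eq_sym.
  by rewrite (_ : (l == j :> nat) = false) ?mulr0 //; exact: negbTE.
have : \prod_i p i != 0 by apply/prodf_neq0 => i _.
move/eqP; apply; apply: poly_eq0_fun => t.
have [i Di] := derive_selection (\col_j t ^+ j) fsel dfs df.
by rewrite (bigD1 i) //= hornerM pE Di subrr mul0r.
Qed.

End GradientSelection.

(** * Multiplicity of the eigenvalue 0 *)

Section NullEigenvalues.
Context {F : fieldType}.

(** An invertible [Li] makes the rows of [Li *m A] from index [r] on vanish. The same rows of Li (X
    - A) are then divisible by X, and [D] collects these n - r factors. *)
Lemma dvdp_Xn_char_poly n (A : 'M[F]_n) : 'X^(n - \rank A) %| char_poly A.
Proof.
set r := \rank A; pose Li := invmx (col_ebase A).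
have [U LiA U0] : exists2 U : 'M[F]_n, Li *m A = U &
    forall i j : 'I_n, (r <= i)%N -> U i j = 0.
  exists (pid_mx r *m row_ebase A).
    by rewrite /Li -[X in _ *m X](mulmx_ebase A) -mulmxA mulKmx ?col_ebase_unit.
  move=> i j ri; rewrite mxE big1 // => l _.
  by rewrite !mxE ltnNge ri andbF mul0r.
pose D : 'M[{poly F}]_n := diag_mx (\row_i (if (i < r)%N then 1 else 'X)).
pose M : 'M[{poly F}]_n := \matrix_(i, j)
  (if (i < r)%N then 'X * (Li i j)%:P - (U i j)%:P else (Li i j)%:P).
have LiX : map_mx polyC Li *m char_poly_mx A = D *m M.
  rewrite /char_poly_mx mulmxBr -map_mxM /= LiA mul_mx_scalar mul_diag_mx.
  apply/matrixP => i j; rewrite !mxE; case: ltnP => ri; first by rewrite mul1r.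
  by rewrite U0 // subr0.
have detD : \det D = 'X^(n - r).
  rewrite det_diag (eq_bigr (fun i : 'I_n => if (r <= i)%N then 'X else 1)).
    rewrite -big_mkcond /= -(big_mkord (fun i => (r <= i)%N) (fun=> 'X)).
    by rewrite -(big_nat_widenl _ _ _ xpredT) // prodr_const_nat.
  by move=> i _; rewrite mxE ltnNge; case: leqP.
have detLi : \det Li != 0.
  by rewrite -unitfE -unitmxE unitmx_inv col_ebase_unit.
rewrite -(dvdpZr _ _ detLi) -mul_polyC -det_map_mx -det_mulmx LiX det_mulmx.
by rewrite detD dvdp_mulr.
Qed.

(** The factors of index at least [d] are coprime to X, so X^k divides the product of the others,
    whose degree is at most [d]. *)
Lemma dvdp_Xn_prod_XsubC n d k (l : 'I_n -> F) :
  (forall i : 'I_n, (d <= i)%N -> l i != 0) ->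
  'X^k %| \prod_i ('X - (l i)%:P) -> (k <= d)%N.
Proof.
move=> lN0; rewrite (bigID (fun i : 'I_n => (i < d)%N)) /= Gauss_dvdpl.
  rewrite -big_filter; set s := [seq i <- _ | _] => /dvdp_leq.
  rewrite size_polyXn size_prod_XsubC ltnS -size_poly_eq0 size_prod_XsubC.
  move=> /(_ isT) /leq_trans; apply.
  rewrite -(size_map val) -[leqRHS](size_iota 0); apply: uniq_leq_size.
    by rewrite map_inj_uniq ?filter_uniq ?index_enum_uniq //; exact: val_inj.
  by move=> _ /mapP[i + ->]; rewrite mem_filter mem_iota => /andP[].
rewrite coprimep_expl // coprimep_sym coprimepX /root horner_prod.
apply/prodf_neq0 => i; rewrite -leqNgt => /lN0.
by rewrite hornerXsubC sub0r oppr_eq0.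
Qed.

End NullEigenvalues.

(** * Positive semidefinite forms, traces and characteristic polynomials *)

Section QuadraticForms.
Context {R : realType} {n : nat}.
Implicit Types (A : 'M[R]_n) (u v w : 'cV[R]_n).

Lemma dotpC u v : dotp u v = dotp v u.
Proof. by rewrite !dotpE; apply: eq_bigr => i _; rewrite mulrC. Qed.

Lemma dotpDr u v w : dotp u (v + w) = dotp u v + dotp u w.
Proof. by rewrite /dotp mulmxDr mxE. Qed.

Lemma dotpZr a u v : dotp u (a *: v) = a * dotp u v.
Proof. by rewrite /dotp -scalemxAr mxE. Qed.

Lemma dotpNr u v : dotp u (- v) = - dotp u v.
Proof. by rewrite -scaleN1r dotpZr mulN1r. Qed.

Lemma dotpDl u v w : dotp (u + v) w = dotp u w + dotp v w.
Proof. by rewrite dotpC dotpDr !(dotpC w). Qed.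

Lemma dotpZl a u v : dotp (a *: u) v = a * dotp u v.
Proof. by rewrite dotpC dotpZr dotpC. Qed.

Lemma dotp_trmx A u v : dotp u (A *m v) = dotp (A^T *m u) v.
Proof. by rewrite /dotp trmx_mul trmxK mulmxA. Qed.

Lemma dotp_ge0 u : 0 <= dotp u u.
Proof. by rewrite dotpE sumr_ge0 // => i _; rewrite -expr2 sqr_ge0. Qed.

Lemma dotp_eq0 u : dotp u u = 0 -> u = 0.
Proof.
rewrite dotpE => /eqP; rewrite psumr_eq0 => [/allP u0|i _].
  apply/colP => i; rewrite mxE.
  by have := u0 i (mem_index_enum _); rewrite mulf_eq0 orbb => /eqP.
by rewrite -expr2 sqr_ge0.
Qed.

Lemma dotp_delta A i j :
  dotp (delta_mx i 0) (A *m delta_mx j 0) = A i j.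
Proof.
rewrite -colE dotpE (bigD1 i) //= big1 ?addr0 => [|l /negbTE li].
  by rewrite !mxE !eqxx mul1r.
by rewrite mxE li mul0r.
Qed.

(** With w = A v, s = w^T w and q = w^T A w, the form at v - t w equals - 2 t s + t^2 q, which is
    negative for a suitable small t > 0 unless s = 0. *)
Lemma psd_ker A v : A^T = A -> (forall u, 0 <= dotp u (A *m u)) ->
  dotp v (A *m v) = 0 -> A *m v = 0.
Proof.
move=> Asym Apsd vAv; apply: dotp_eq0; set w := A *m v.
have s0 := dotp_ge0 w; have q0 := Apsd w.
have vAw : dotp v (A *m w) = dotp w w by rewrite dotp_trmx Asym.
move: s0 q0; set s := dotp w w; set q := dotp w (A *m w) => s0 q0.
(* Dividing by q + 1 rather than q covers q = 0. Since s = t (q + 1), the form becomes - t^2 (q +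
   2), which forces t = 0. *)
pose t := s / (q + 1).
have := Apsd (v + (- t) *: w).
rewrite mulmxDr -scalemxAr !(dotpDl, dotpDr, dotpZl, dotpZr).
rewrite vAv vAw -/w -/s -/q.
have q1 : 0 < q + 1 by lra.
have tE : t * (q + 1) = s by rewrite /t divfK // gt_eqF.
have t0 : 0 <= t by rewrite /t divr_ge0 // ltW.
nra.
Qed.

(** The form at e_i + e_j and at e_i - e_j bounds twice the absolute value of the entry by A_ii +
    A_jj, and each diagonal entry is at most the trace. *)
Lemma psd_entry_le_trace A i j : A^T = A ->
  (forall u, 0 <= dotp u (A *m u)) -> `|A i j| <= \tr A.
Proof.
move=> Asym Apsd.
have diag0 l : 0 <= A l l by rewrite -dotp_delta.
have diag_tr l : A l l <= \tr A.
  by rewrite /mxtrace (bigD1 l) //= lerDl sumr_ge0.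
have e s : dotp (delta_mx i 0 + s *: delta_mx j 0)
    (A *m (delta_mx i 0 + s *: delta_mx j 0)) =
    A i i + s * A i j + s * (A i j + s * A j j).
  rewrite mulmxDr -scalemxAr !(dotpDl, dotpDr, dotpZl, dotpZr) !dotp_delta.
  by rewrite -[in A j i]Asym mxE; ring.
have := Apsd (delta_mx i 0 + 1 *: delta_mx j 0).
have := Apsd (delta_mx i 0 + (-1) *: delta_mx j 0).
rewrite !e ler_norml; have := diag_tr i; have := diag_tr j.
by move=> *; apply/andP; split; lra.
Qed.

Lemma posdefmxP A : posdefmx A ->
  A^T = A /\ forall u, 0 <= dotp u (A *m u).
Proof.
move=> [/is_hermitianmxP Asym Apos]; split.
  by rewrite [RHS]Asym expr0 scale1r; apply/matrixP => i j; rewrite !mxE.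
move=> u; have [->|/Apos/ltW//] := eqVneq u 0.
by rewrite mulmx0 dotpE big1 // => i _; rewrite mxE mul0r.
Qed.

(** Both sides are, up to sign, the coefficient of X^(n-1) in the characteristic polynomial. This
    coefficient makes sense only for n > 0, hence the case distinction. *)
Lemma trace_eigenvalues A l : ordered_eigenvalues A l -> \tr A = \sum_i l i.
Proof.
move=> [_ Al]; have [n0|n0] := posnP n.
  move: A l Al; rewrite n0 => A l _.
  by rewrite /mxtrace !big_ord0.
apply: oppr_inj; rewrite -char_poly_trace // Al.
have sE : size [seq l i | i <- index_enum 'I_n] = n.
  by rewrite size_map -sum1_size sum1_card card_ord.
rewrite -(big_map l xpredT (fun a => 'X - a%:P)) -(big_map l xpredT id).
by rewrite -[in n.-1]sE coefPn_prod_XsubC // sE -lt0n.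
Qed.

Lemma horner_char_poly A t : (char_poly A).[t] = \det (t%:M - A).
Proof.
rewrite -horner_evalE -det_map_mx; congr (\det _).
apply/matrixP => i j; rewrite !mxE /horner_eval.
by rewrite rmorphB rmorphMn /= !horner_evalE !hornerE.
Qed.

End QuadraticForms.

(** For each fixed t the determinants of t - H k have both values at t as limits, and polynomials
    that agree at every t are equal. Eigenvalues thus pass to the limit with their
    multiplicities. *)
Lemma char_poly_limit {R : realType} {n : nat} {T : Type} (F : set_system T)
    {FF : ProperFilter F} (H : T -> 'M[R]_n) (l : T -> 'I_n -> R)
    (A : 'M[R]_n) (a : 'I_n -> R) :
  (forall k, char_poly (H k) = \prod_i ('X - (l k i)%:P)) ->
  H @ F --> A -> (forall i, l k i @[k --> F] --> a i) ->
  char_poly A = \prod_i ('X - (a i)%:P).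
Proof.
move=> Hl HA la; apply/eqP; rewrite -subr_eq0; apply/eqP/poly_eq0_fun => t.
apply/eqP; rewrite hornerD hornerN subr_eq0; apply/eqP.
rewrite horner_char_poly horner_prod.
have Ht : \det (t%:M - H k) @[k --> F] --> \det (t%:M - A).
  by apply: cvg_det; apply: cvgB => //; exact: cvg_cst.
apply: (norm_cvg_unique Ht) => /=.
under eq_cvg => k do rewrite -horner_char_poly Hl horner_prod.
apply: cvg_prodr => i; rewrite hornerXsubC.
under eq_cvg do rewrite hornerXsubC.
by apply: cvgB => //; exact: cvg_cst.
Qed.

(** * Spans and kernels of symmetric matrices *)

Section SpanKernels.
Context {R : realType} {n : nat}.

Lemma span_combination (I : finType) (s : seq I) (d : I -> 'cV[R]_n) v :
  v \in <<[seq d i | i <- s]>>%VS -> exists c : I -> R, v = \sum_i c i *: d i.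
Proof.
elim: s v => [|i s IHs] v /=.
  rewrite span_nil memv0 => /eqP ->; exists (fun=> 0).
  by rewrite big1 // => i _; rewrite scale0r.
rewrite span_cons => /memv_addP[_ /vlineP[a ->] [w /IHs[c ->] ->]].
exists (fun j => (if j == i then a else 0) + c j).
rewrite (eq_bigr _ (fun _ _ => scalerDl _ _ _)) big_split /=; congr (_ + _).
rewrite (bigD1 i) //= eqxx big1 ?addr0 // => j /negbTE ->.
by rewrite scale0r.
Qed.

Lemma span_ker (A : 'M[R]_n) (s : seq 'cV[R]_n) v :
  (forall u, u \in s -> A *m u = 0) -> v \in << s >>%VS -> A *m v = 0.
Proof.
move=> As; suff /subvP sA : (<< s >>%VS <= lker (linfun (mulmx A)))%VS.
  by move=> /sA; rewrite memv_ker lfunE => /eqP.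
by apply/span_subvP => u /As Au; rewrite memv_ker lfunE /= Au.
Qed.

(** If [v] were outside [V], then [v] and a basis of [V] would be dim V + 1 independent kernel
    vectors. So 0 would be an eigenvalue of multiplicity above dim V, but only the first dim V of
    the [a i] can vanish. *)
Lemma ker_sub_vspace (A : 'M[R]_n) (V : {vspace 'cV[R]_n}) (a : 'I_n -> R) v :
  A^T = A -> (forall w, w \in V -> A *m w = 0) ->
  char_poly A = \prod_i ('X - (a i)%:P) ->
  (forall i : 'I_n, (\dim V <= i)%N -> a i != 0) ->
  A *m v = 0 -> v \in V.
Proof.
move=> Asym AV Aa aN0 Av; apply: contraT => vV.
set d := \dim V; pose X : d.+1.-tuple 'cV[R]_n := [tuple of v :: vbasis V].
have Xfree : free X.
  by rewrite free_cons (span_basis (vbasisP V)) vV (basis_free (vbasisP V)).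
pose B : 'M[R]_(d.+1, n) := \matrix_(i, j) X`_i j 0.
have Bfree : row_free B.
  apply: inj_row_free => u uB; apply/rowP => i; rewrite [RHS]mxE.
  have /freeP/(_ (u 0)) := Xfree; apply; apply/colP => j.
  have /rowP/(_ j) := uB; rewrite !mxE => uBj; rewrite -[RHS]uBj summxE.
  by apply: eq_bigr => l _; rewrite !mxE.
have AX i : A *m X`_i = 0.
  have [iX|iX] := ltnP i (size X); last by rewrite nth_default // mulmx0.
  have := mem_nth 0 iX; rewrite inE => /predU1P[-> //|/vbasis_mem]; exact: AV.
(* The rows of [B] are transposed kernel vectors, so symmetry of [A] turns A X = 0 into B A = 0. *)
have BA : B *m A = 0.
  apply/matrixP => i j; have /colP/(_ j) := AX i; rewrite !mxE => AXij.
  rewrite -[RHS]AXij.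
  by apply: eq_bigr => l _; rewrite !mxE -[in LHS]Asym mxE mulrC.
have : (d.+1 <= n - \rank A)%N.
  have := mulmx0_rank_max BA; rewrite (eqP Bfree) => ?.
  by rewrite leq_subRL ?rank_leq_row // addnC.
move=> /leq_trans/(_ (dvdp_Xn_prod_XsubC aN0 _)).
by rewrite -Aa dvdp_Xn_char_poly ltnn => /(_ isT).
Qed.

End SpanKernels.

(** * Stability of positive coefficients and shrinking of sublevel sets *)

Section NearMinimizer.
Context {R : realType} {n : nat}.

(** The conditions on b say b A(y) = (1, 0), where A(y) has the rows (1, g_i(y)). Affine
    independence gives A(xs) a right inverse B. Near xs the product A(y) B is close to the identity,
    so b is close to (1, 0) B, the normalized [alpha]. *)
Lemma near_affine_zero_ge0 (m : nat) (g : 'I_m.+1 -> 'cV[R]_n -> 'cV[R]_n)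
    (xs : 'cV[R]_n) (alpha : 'I_m.+1 -> R) :
  (forall i, {for xs, continuous (g i)}) ->
  affinely_independent (fun i => g i xs) ->
  (forall i, 0 < alpha i) -> \sum_i alpha i *: g i xs = 0 ->
  \forall y \near xs, forall b : 'I_m.+1 -> R,
    \sum_i b i = 1 -> \sum_i b i *: g i y = 0 -> forall i, 0 <= b i.
Proof.
move=> gC gaff alpha0 galpha.
pose A y : 'M[R]_(m.+1, 1 + n) :=
  row_mx (const_mx 1) (\matrix_(i, j) g i y j 0).
have rowA (b : 'I_m.+1 -> R) y :
    (\row_i b i) *m A y = row_mx (\sum_i b i)%:M (\sum_i b i *: g i y)^T.
  rewrite mul_mx_row; congr row_mx; apply/matrixP => i j.
    by rewrite !ord1 !mxE mulr1n; apply: eq_bigr => l _; rewrite !mxE mulr1.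
  by rewrite ord1 !mxE summxE; apply: eq_bigr => l _; rewrite !mxE.
have /row_freeP[B AB] : row_free (A xs).
  apply: inj_row_free => u.
  have -> : u = \row_i u 0 i by apply/rowP => i; rewrite mxE.
  rewrite rowA => uA; have := congr1 lsubmx uA; rewrite row_mxKl linear0.
  move=> /matrixP/(_ 0 0); rewrite !mxE mulr1n => u1.
  have := congr1 (trmx \o rsubmx) uA; rewrite /= row_mxKr trmxK !linear0 => ug.
  by apply/rowP => i; rewrite !mxE; apply: gaff u1 ug i.
pose S : R := \sum_i alpha i.
have S0 : 0 < S.
  by rewrite /S big_ord_recl ltr_pwDl // sumr_ge0 // => i _; exact: ltW.
pose a i : R := alpha i / S.
have a0 i : 0 < a i by rewrite divr_gt0.
have a1 : \sum_i a i = 1 by rewrite -mulr_suml divff // gt_eqF.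
have ga : \sum_i a i *: g i xs = 0.
  rewrite (eq_bigr (fun i => S^-1 *: (alpha i *: g i xs))) => [|i _].
    by rewrite -scaler_sumr galpha scaler0.
  by rewrite scalerA mulrC.
have AC : A y *m B - 1%:M @[y --> xs] --> (0 : 'M[R]_m.+1).
  rewrite -[X in _ --> X](subrr 1%:M) -[in X in X - _]AB.
  apply: (@cvgB _ _ _ (nbhs xs) _ (fun y => A y *m B) (fun=> 1%:M));
    last exact: cvg_cst.
  apply: (cvg_mulmx (u := A) (v := fun=> B)); last exact: cvg_cst.
  apply/cvg_mxP => i j.
  have AE y : A y i j = if fintype.split j is inr l then g i y l 0 else 1.
    by rewrite mxE; case: fintype.split => l; rewrite mxE.
  rewrite AE; under eq_cvg do rewrite AE.
  case: fintype.split => [_|l]; first exact: cvg_cst.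
  by have /cvg_mxP := gC i; exact.
have Esmall (e : R) : 0 < e -> \forall y \near xs, forall i j,
    `|(A y *m B - 1%:M) i j| <= e.
  move=> e0; apply: (@filter_forall _ _ _ (nbhs xs)) => i.
  apply: (@filter_forall _ _ _ (nbhs xs)) => j.
  move/cvg_mxP : AC => /(_ i j); rewrite mxE => /cvgr0Pnorm_le; exact.
(* The two tolerances are chosen so that the second gives N <= 2 for N the sum of the |b_j|, and the
   first then gives |a_l - b_l| <= N a_l / 2 <= a_l. *)
have Esmalla : \forall y \near xs, forall l i j,
    `|(A y *m B - 1%:M) i j| <= a l / 2.
  by apply: (@filter_forall _ _ _ (nbhs xs)) => l; apply: Esmall;
    rewrite divr_gt0.
have Esmall1 : \forall y \near xs, forall i j,
    `|(A y *m B - 1%:M) i j| <= (2 * m.+1%:R)^-1.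
  by apply: Esmall; rewrite invr_gt0 mulr_gt0.
apply: filterS2 Esmalla Esmall1 => y Ea E1 b b1 gb i.
have ba l : a l - b l = \sum_j b j * (A y *m B - 1%:M) j l.
  have : (\row_i b i) *m (A y *m B) = (\row_i a i) *m (A xs *m B).
    by rewrite !mulmxA !rowA a1 b1 ga gb.
  rewrite AB mulmx1 => /rowP/(_ l); rewrite [RHS]mxE => <-.
  have -> : b l = ((\row_i b i) *m 1%:M) 0 l by rewrite mulmx1 mxE.
  rewrite -[X in X - _]/(((\row_i b i) *m (A y *m B)) 0 l).
  have -> (U V : 'rV[R]_m.+1) : U 0 l - V 0 l = (U - V) 0 l by rewrite !mxE.
  by rewrite -mulmxBr mxE; apply: eq_bigr => j _; rewrite mxE.
pose N : R := \sum_j `|b j|.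
have N0 : 0 <= N by apply: sumr_ge0.
have dist l (e : R) : (forall j, `|(A y *m B - 1%:M) j l| <= e) ->
    `|a l - b l| <= N * e.
  move=> Ee; rewrite ba (le_trans (ler_norm_sum _ _ _)) // mulr_suml.
  by apply: ler_sum => j _; rewrite normrM ler_wpM2l.
(* The error is known only relative to N. Summing |b_j| <= a_j + N / (2 (m + 1)) over the m + 1
   indices gives N <= 1 + N / 2. *)
have N2 : N <= 2.
  have : N <= \sum_j (a j + N * (2 * m.+1%:R)^-1).
    apply: ler_sum => j _.
    have := dist j _ (fun l => E1 l j).
    have := a0 j; rewrite !ler_norml => aj /andP[].
    by set e : R := N / _; move=> e1 e2; apply/andP; split; lra.
  have NE : (N / (2 * m.+1%:R)) *+ m.+1 = N / 2.
    by rewrite -mulr_natr; field; rewrite addrC natr1 pnatr_eq0.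
  rewrite big_split /= a1 sumr_const card_ord NE; lra.
have := dist i _ (fun l => Ea i l i).
have := a0 i; rewrite ler_norml => ai /andP[_].
nra.
Qed.

(** Otherwise there are points outside [V] whose values tend to the minimum. They are bounded, and
    their limit along an ultrafilter can only be the unique minimizer, of which [V] is a
    neighborhood. *)
Lemma sublevel_near (f : 'cV[R]_n -> R) (xs z : 'cV[R]_n) (V : set 'cV[R]_n) :
  continuous f -> (forall x, x <> xs -> f xs < f x) -> z <> xs ->
  bounded_set [set x | f x <= f z] -> nbhs xs V ->
  exists2 e, 0 < e & forall y, f y <= f xs + e -> V y.
Proof.
move=> fC fmin zxs [M [_ fM]] xsV; apply: contrapT => nV.
have fz : 0 < f z - f xs by rewrite subr_gt0 fmin.
(* The gap f z - f xs in the tolerance keeps every [u k] in the bounded sublevel set of [z]. *)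
have /choice[u uP] (k : nat) : exists y,
    f y <= f xs + (f z - f xs) / k.+1%:R /\ ~ V y.
  apply: contrapT => /forallNP uN; apply: nV.
  exists ((f z - f xs) / k.+1%:R); first by rewrite divr_gt0.
  by move=> y fy; apply: contrapT => Vy; apply: (uN y).
have [F [UF Foo]] := ultraFilterLemma (eventually_filter).
have [|l ul] := @ultra_bounded_cvg_mx R nat F n 1 u (M + 1) UF.
  move=> k i j; apply: le_trans (fM (M + 1) _ (u k) _).
  - rewrite [leRHS]/Num.Def.normr /= mx_normrE.
    exact: (le_bigmax _ (fun ij => `|u k ij.1 ij.2|) (i, j)).
  - by rewrite ltrDl.
  - rewrite /= (le_trans (uP k).1) // -lerBrDl ler_pdivrMr //.
    by rewrite ler_peMr ?ler1n // ltW.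
have fu := cvg_comp _ _ ul (fC l).
have fl : f l <= f xs.
  have bd : f xs + (f z - f xs) / k.+1%:R @[k --> F] --> f xs.
    rewrite -[X in _ --> X]addr0 -[X in _ --> _ + X](mulr0 (f z - f xs)).
    apply: cvgD; first exact: cvg_cst.
    apply: cvgM; first exact: cvg_cst.
    by apply: cvg_trans (cvg_harmonic); apply: cvg_app.
  apply: ler_cvg_to fu bd _.
  by apply: filterE => k; exact: (uP k).1.
have lxs : l = xs by apply: contrapT => /fmin; rewrite ltNge fl.
have /filter_ex[k] : F (u @^-1` V) by apply: ul; rewrite lxs.
exact: (uP k).2.
Qed.

End NearMinimizer.

(** * Descent, and limits of the quasi-Newton matrices and gradients *)

Section QuasiNewtonLimits.
Context {R : realType} {n : nat}.

Lemma quasi_newton_posdef (f : 'cV[R]_n -> R) c1 c2 x H t :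
  quasi_newton f c1 c2 x H t ->
  (forall k, ~ Omega f (x k) /\ grad f (x k) <> 0) -> forall k, posdefmx (H k).
Proof.
move=> qn xok [|k]; first exact: qn_matrix0 qn.
by have [] := qn_update qn (fun l _ => xok l) (xok k.+1).1.
Qed.

Lemma quasi_newton_descent (f : 'cV[R]_n -> R) c1 c2 x H t :
  0 < c1 -> quasi_newton f c1 c2 x H t ->
  (forall k, ~ Omega f (x k) /\ grad f (x k) <> 0) ->
  forall k, f (x k) <= f (x 0%N).
Proof.
move=> c10 qn xok; elim=> [//|k fk0]; apply: le_trans fk0.
have [[tk _ fk _] xk] := qn_step qn (k := k) (fun l _ => xok l).
move: fk; rewrite -xk => /le_trans; apply.
rewrite gerDl mulr_ge0_le0 //; first by rewrite mulr_ge0 // ltW.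
have [_ /(_ (grad f (x k)))] := posdefmxP (quasi_newton_posdef qn xok k).
by rewrite dotpNr oppr_le0.
Qed.

(* In the limit the curvature condition reads - a^T A a >= - c2 a^T A a. *)
Lemma curvature_limit (F : set_system nat) {FF : ProperFilter F} (c2 : R)
    (g : nat -> 'cV[R]_n) (H : nat -> 'M[R]_n) (A : 'M[R]_n) (a b : 'cV[R]_n) :
  c2 < 1 -> A^T = A -> (forall u, 0 <= dotp u (A *m u)) ->
  (forall k, c2 * dotp (g k) (- (H k *m g k)) <=
             dotp (g k.+1) (- (H k *m g k))) ->
  H @ F --> A -> g @ F --> a -> g k.+1 @[k --> F] --> b ->
  A *m a = A *m b -> A *m a = 0.
Proof.
move=> c21 Asym Apsd curv HA ga gb Aab; apply: psd_ker => //.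
have Hg : - (H k *m g k) @[k --> F] --> - (A *m a).
  by apply: cvgN; exact: cvg_mulmx.
have lhs : c2 * dotp (g k) (- (H k *m g k)) @[k --> F] -->
    c2 * dotp a (- (A *m a)).
  by apply: cvgM; [exact: cvg_cst|exact: cvg_dotp].
have qc2 : c2 * dotp a (- (A *m a)) <= dotp b (- (A *m a)).
  by apply: ler_cvg_to lhs (cvg_dotp gb Hg) _; exact: filterE.
have bAa : dotp b (A *m a) = dotp a (A *m a).
  by rewrite dotp_trmx Asym -Aab dotpC.
have := Apsd a; move: qc2; rewrite !dotpNr bAa.
by set q := dotp a (A *m a) => qc2 q0; nra.
Qed.

(** As the eigenvalues are sorted and [d < n], a bound on those of index at least [d] bounds them
    all. Entries are at most the trace, the sum of the eigenvalues. *)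
Lemma quasi_newton_entry_le (H : nat -> 'M[R]_n) (lambda : nat -> 'I_n -> R)
    (d : nat) (sigma : R) :
  (forall k, posdefmx (H k)) ->
  (forall k, ordered_eigenvalues (H k) (lambda k)) ->
  (d < n)%N -> (forall k (j : 'I_n), (d <= j)%N -> lambda k j <= sigma) ->
  (forall k j, lambda k j <= sigma) /\
  forall k i j, `|H k i j| <= sigma *+ n.
Proof.
move=> Hpos Hl dn lsigma.
have ls k j : lambda k j <= sigma.
  have jd : (maxn d j < n)%N by rewrite gtn_max dn ltn_ord.
  apply: le_trans (lsigma k (Ordinal jd) (leq_maxl _ _)).
  by apply: (Hl k).1; exact: leq_maxr.
split=> // k i j; have [Hsym Hpsd] := posdefmxP (Hpos k).
apply: le_trans (psd_entry_le_trace i j Hsym Hpsd) _.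
rewrite (trace_eigenvalues (Hl k)) -[X in _ *+ X]card_ord -sumr_const.
exact: ler_sum.
Qed.

Lemma grad_limit_in_Nspace (m : nat) (f : 'cV[R]_n -> R)
    (fs : 'I_m.+1 -> 'cV[R]_n -> R) c1 c2 x H t
    (lambda : nat -> 'I_n -> R) (xbar : 'cV[R]_n) (sigmaL sigmaU : R) :
  continuous_selection f fs -> (forall i, C1 (fs i)) -> c2 < 1 ->
  quasi_newton f c1 c2 x H t ->
  (forall k, ordered_eigenvalues (H k) (lambda k) /\
             forall j, 0 < lambda k j) ->
  (forall k, ~ Omega f (x k) /\ grad f (x k) <> 0) ->
  x k @[k --> \oo] --> xbar -> 0 < sigmaL ->
  (forall k (j : 'I_n), (\dim (Nspace fs xbar) <= j)%N ->
     sigmaL <= lambda k j <= sigmaU) ->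
  (forall i, i != ord0 ->
     H k *m (grad (fs i) xbar - grad (fs ord0) xbar)
       @[k --> \oo] --> (0 : 'cV[R]_n)) ->
  grad (fs ord0) xbar \in Nspace fs xbar.
Proof.
move=> fsel fsC1 c21 qn Hl xok xcvg sL0 lsigma Hcvg.
set V := Nspace fs xbar; pose g i := grad (fs i) xbar.
(* If dim V = n, the space [V] is everything; otherwise some eigenvalue has index at least dim V,
   and the bound applies. *)
have [nV|Vn] := leqP n (\dim V).
  suff -> : V = fullv by exact: memvf.
  by apply/eqP; rewrite eqEdim subvf dimvf /dim /= muln1.
have Hpos := quasi_newton_posdef qn xok.
have [ls Hbnd] := quasi_newton_entry_le Hpos (fun k => (Hl k).1) Vn
  (fun k j dj => (andP (lsigma k j dj)).2).
have [F [UF Foo]] := ultraFilterLemma eventually_filter.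
have [A HA] := ultra_bounded_cvg_mx UF Hbnd.
have /choice[a la] (i : 'I_n) : exists a : R, lambda k i @[k --> F] --> a.
  apply: (@ultra_bounded_cvgr _ _ _ _ sigmaU UF) => k.
  by rewrite ger0_norm ?ls // ltW //; exact: (Hl k).2.
have Aa : char_poly A = \prod_i ('X - (a i)%:P).
  exact: char_poly_limit (fun k => (Hl k).1.2) HA la.
have aN0 (i : 'I_n) : (\dim V <= i)%N -> a i != 0.
  move=> Vi; rewrite gt_eqF // (lt_le_trans sL0) //.
  apply: cvgr_to_ge (la i) _; apply: filterE => k.
  by have /andP[] := lsigma k i Vi.
have Asym : A^T = A.
  apply/matrixP => i j; rewrite mxE.
  have /cvg_mxP HA' := HA; apply: (norm_cvg_unique (HA' j i)).
  have Hsym k : H k j i = H k i j.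
    by rewrite -[in RHS](posdefmxP (Hpos k)).1 mxE.
  by rewrite /=; under eq_cvg do rewrite Hsym; exact: HA'.
have Apsd u : 0 <= dotp u (A *m u).
  have HAu : dotp u (H k *m u) @[k --> F] --> dotp u (A *m u).
    by apply: cvg_dotp; [exact: cvg_cst|apply: cvg_mulmx => //; exact: cvg_cst].
  apply: cvgr_to_ge HAu _; apply: filterE => k.
  exact: (posdefmxP (Hpos k)).2.
have Ag i : A *m (g i - g ord0) = 0.
  have [->|i0] := eqVneq i ord0; first by rewrite subrr mulmx0.
  have HAg : H k *m (g i - g ord0) @[k --> F] --> A *m (g i - g ord0).
    by apply: cvg_mulmx => //; exact: cvg_cst.
  apply: (norm_cvg_unique HAg).
  exact: (cvg_trans (cvg_app _ Foo) (Hcvg i i0)).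
have AV w : w \in V -> A *m w = 0.
  by apply: span_ker => u /mapP[i _ ->]; exact: Ag.
(* Used for the iterates and for their shift. The two limiting indices may differ, which is harmless
   because all the [A *m g l] coincide. *)
have gcvg (y : nat -> 'cV[R]_n) : (forall k, ~ Omega f (y k)) ->
    y @ \oo --> xbar -> exists i, grad f (y k) @[k --> F] --> g i.
  move=> yok ycvg.
  have [|i Fi] := ultra_cover
    (P := fun i k => grad f (y k) = grad (fs i) (y k)) UF.
    apply: filterE => k; apply: grad_selection => // [i|].
      exact: (fsC1 i).1.
    exact: contrapT (yok k).
  exists i; have gy : grad (fs i) (y k) @[k --> F] --> g i.
    exact: cvg_comp _ _ (cvg_trans (cvg_app _ Foo) ycvg) ((fsC1 i).2 xbar).
  apply: cvg_trans gy; apply: near_eq_cvg.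
  by apply: filterS Fi => k /= ->.
have [i gi] := gcvg x (fun k => (xok k).1) xcvg.
have [|j gj] := gcvg (fun k => x k.+1) (fun k => (xok k.+1).1).
  by rewrite (cvg_shiftS x).
apply: (ker_sub_vspace Asym AV Aa aN0).
have AgE l : A *m g l = A *m g ord0.
  by apply/eqP; rewrite -subr_eq0 -mulmxBr Ag.
rewrite -(AgE i); apply: (curvature_limit c21 Asym Apsd _ HA gi gj).
  move=> k; have [[_ _ _]] := qn_step qn (k := k) (fun l _ => xok l).
  by move=> curv xk; rewrite -xk in curv.
by rewrite !AgE.
Qed.

End QuasiNewtonLimits.

(** * Affine combinations, sequences in infinite index sets, and the conclusion *)

Lemma Nspace_affine_zero (R : realType) (n m : nat)
    (fs : 'I_m.+1 -> 'cV[R]_n -> R) (y : 'cV[R]_n) :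
  grad (fs ord0) y \in Nspace fs y ->
  exists b : 'I_m.+1 -> R,
    \sum_i b i = 1 /\ \sum_i b i *: grad (fs i) y = 0.
Proof.
move=> /span_combination[c gc].
(* From g_0 = sum of c_i (g_i - g_0) one gets (1 + sum of c_i) g_0 - sum of c_i g_i = 0, with
   coefficients of sum 1. *)
exists (fun i => (if i == ord0 then 1 + \sum_j c j else 0) - c i).
rewrite sumrB -big_mkcond big_pred1_eq addrK; split=> //.
rewrite (eq_bigr _ (fun _ _ => scalerBl _ _ _)) sumrB.
rewrite (bigD1 ord0) //= [X in _ + X - _]big1 => [|i /negbTE i0].
  rewrite addr0 scalerDl scale1r {1}gc.
  rewrite (eq_bigr _ (fun _ _ => scalerBr _ _ _)) sumrB scaler_suml.
  by rewrite subrK subrr.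
by rewrite i0 scale0r.
Qed.

(** An infinite set of naturals has an element [phi k >= k] for each k. [phi] need not be monotone,
    as this inequality alone makes it tend to infinity. *)
Lemma infinite_set_cvg (T : topologicalType) (u : nat -> T) (l : T)
    (S : set nat) :
  infinite_set S -> u @ \oo --> l ->
  exists2 phi : nat -> nat, forall k, S (phi k) & u (phi k) @[k --> \oo] --> l.
Proof.
move=> Sinf ul.
have /choice[phi phiS] (k : nat) : exists j, S j /\ (k <= j)%N.
  apply: contrapT => /forallNP Sk; apply: Sinf.
  apply: (sub_finite_set _ (finite_II k)) => j Sj.
  by rewrite /= ltnNge; apply/negP => kj; apply: (Sk j).
exists phi => [k|]; first exact: (phiS k).1.
apply: cvg_comp ul; apply/cvgnyPge => N.
by near=> k; apply: leq_trans (phiS k).2; near: k; exact: nbhs_infty_ge.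
Unshelve. all: by end_near. Qed.

Theorem theorem1 (R : realType) (n m : nat) (f : 'cV[R]_n -> R)
    (fs : 'I_m.+1 -> 'cV[R]_n -> R) (xs : 'cV[R]_n)
    (f_sel : continuous_selection f fs)
    (fs_C1 : forall i, C1 (fs i))
    (fs_lip : forall i, locally_lipschitz (grad (fs i)))
    (xs_crit : critical f xs)
    (xs_comb : exists alpha : 'I_m.+1 -> R,
       (forall i, 0 < alpha i) /\ \sum_i alpha i *: grad (fs i) xs = 0)
    (xs_aff : affinely_independent (fun i => grad (fs i) xs))
    (xs_min : forall x, x <> xs -> f xs < f x)
    (xs_bnd : exists2 z : 'cV[R]_n, z <> xs & bounded_set [set x | f x <= f z]) :
  exists U : set 'cV[R]_n,
    [/\ open U, U xs &
      forall (c1 c2 : R) (x : nat -> 'cV[R]_n) (H : nat -> 'M[R]_n)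
             (t : nat -> R) (lambda : nat -> 'I_n -> R) (xbar : 'cV[R]_n),
        0 < c1 < 1 -> 0 < c2 < 1 -> c1 < c2 ->
        U (x 0%N) ->
        quasi_newton f c1 c2 x H t ->
        (forall k, ordered_eigenvalues (H k) (lambda k) /\
                   forall j, 0 < lambda k j) ->
        (forall k, ~ Omega f (x k) /\ grad f (x k) <> 0) ->
        x k @[k --> \oo] --> xbar ->
        (forall i, infinite_set [set k | Ig f fs (x k) i]) ->
        (exists sigmaL sigmaU : R, [/\ 0 < sigmaL, 0 < sigmaU &
           forall k (j : 'I_n), (\dim (Nspace fs xbar) <= j)%N ->
             sigmaL <= lambda k j <= sigmaU]) ->
        (forall i, i != ord0 ->
           H k *m (grad (fs i) xbar - grad (fs ord0) xbar)
             @[k --> \oo] --> (0 : 'cV[R]_n)) ->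
        critical f xbar].
Proof.
have [alpha [alpha0 galpha]] := xs_comb.
have xsV := near_affine_zero_ge0 (fun i => (fs_C1 i).2 xs) xs_aff alpha0 galpha.
have [z zxs zbnd] := xs_bnd.
have [e e0 eV] := sublevel_near f_sel.1 xs_min zxs zbnd xsV.
(* A sublevel set is chosen because descent keeps the iterates in it. Hence f xbar <= f xs + e,
   which puts [xbar] where affine zero combinations have nonnegative coefficients. *)
exists [set y | f y < f xs + e]; split.
- rewrite -[X in open X]/(f @^-1` [set r | r < f xs + e]).
  by apply: open_comp => [y _|]; [exact: f_sel.1|exact: open_lt].
- by rewrite /= ltrDl.
move=> c1 c2 x H t lambda xbar /andP[c10 _] /andP[_ c21] _ x0U qn Hl xok xcvg.
move=> Ig_inf [sL [sU [sL0 _ lsigma]]] Hcvg.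
have fxbar : f xbar <= f xs + e.
  have fx := cvg_comp _ _ xcvg (f_sel.1 xbar).
  apply: cvgr_to_le fx _; apply: filterE => k.
  exact: le_trans (quasi_newton_descent c10 qn xok k) (ltW x0U).
have := grad_limit_in_Nspace f_sel fs_C1 c21 qn Hl xok xcvg sL0 lsigma Hcvg.
move=> /Nspace_affine_zero[b [b1 gb]].
exists m.+1, b, (fun i => grad (fs i) xbar); split=> //.
  exact: (eV _ fxbar).
(* Each gradient of [fs i] at [xbar] is a limit of gradients of [f], taken along iterates whose [Ig]
   contains i. *)
move=> i; have [phi phiS xphi] := infinite_set_cvg (Ig_inf i) xcvg.
exists (x \o phi); split=> //= [j|]; first exact: (xok _).1.
have gphi := cvg_comp _ _ xphi ((fs_C1 i).2 xbar).
apply: cvg_trans gphi; apply: near_eq_cvg.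
by apply: filterE => j /=; rewrite (phiS j).2.
Qed.
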